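(* Let $\mu$ be a Borel measure on $\mathbb{R}$ and let $\mathcal{K}$ be the restriction of the mean $\mathcal{M}^{\mu}$ to bounded sets. Let $H\subset\mathbb{R}$ be a $\mu$-measurable set such that $\mu(H\cap[x,y])<+\infty$ for all real $x\le y$. If $\inf H>-\infty$ and $\mu(H)=+\infty$, then $\hat{\mathcal{K}}(H)=+\infty$.
   Context: For a Borel measure $\mu$ on $\mathbb{R}$ and a $\mu$-measurable $H\subset\mathbb{R}$ with $0<\mu(H)<+\infty$, $\mathcal{M}^{\mu}(H)=\frac{\int_H x\,d\mu}{\mu(H)}$. For $\mathcal{K}=\mathcal{M}^{\mu}$ restricted to bounded sets, and a $\mu$-measurable $H\subset\mathbb{R}$ such that $\mu(H)>0$ and $\mu(H\cap[x,y])<+\infty$ for all real $x\le y$, the extension is $\hat{\mathcal{K}}(H)=\lim_{x\to-\infty,\,y\to+\infty}\mathcal{M}^{\mu}(H\cap[x,y])$ if this double limit ($x,y$ tending independently, over those $x\le y$ with $\mu(H\cap[x,y])>0$, which holds for all sufficiently small $x$ and large $y$) exists in $\bar{\mathbb{R}}=\mathbb{R}\cup\{-\infty,+\infty\}$. *)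

(* Defs.v *)
From mathcomp Require Import all_boot all_order all_algebra.
From mathcomp Require Import all_classical all_reals all_analysis.
Import Order.TTheory GRing.Theory Num.Theory.
Import numFieldNormedType.Exports.

Set Implicit Arguments.
Unset Strict Implicit.
Unset Printing Implicit Defensive.

Local Open Scope classical_set_scope.
Local Open Scope ring_scope.
Local Open Scope ereal_scope.

(* A mean is a partial function on sets of reals; [mean_val K] is meaningful
   only on [mean_dom K]. *)
Record mean (R : realType) := Mean {
  mean_dom : set (set R) ;
  mean_val : set R -> \bar R }.

Definition restrict_mean (R : realType) (P : set (set R)) (K : mean R) :=
  Mean (mean_dom K `&` P) (mean_val K).

Definition bounded_restriction (R : realType) (K : mean R) :=
  restrict_mean bounded_set K.

Section measure_mean.
Context (R : realType) (mu : {measure set (measurableTypeR R) -> \bar R}).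

(* mu-measurability is measurability for the complete extension of [mu], the
   restriction of the outer measure [mu^*] to its Caratheodory sets: every
   Borel set is mu-measurable, and so is every subset of a Borel mu-null set. *)
Definition mu_measurable (H : set R) := (mu^*)%mu.-cara.-measurable H.

Definition mu_bar : {measure set (caratheodory_type (mu^*)%mu) -> \bar R} :=
  @completed_measure_extension _ _ R mu.

Definition measure_mean : mean R := Mean
  [set H | mu_measurable H /\ 0 < mu_bar H < +oo]
  (fun H => (\int[mu_bar]_(x in H) (x : R)%:E) / mu_bar H).

Definition locally_finite_on (H : set R) :=
  forall x y : R, (x <= y)%R -> mu_bar (H `&` `[x, y]) < +oo.

(* x --> -oo and y --> +oo independently, along the pairs x <= y for which
   the trace of [H] on [x, y] has positive measure *)
Definition truncation_filter (H : set R) : set_system (R * R) :=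
  within [set p | (p.1 <= p.2)%R /\ 0 < mu_bar (H `&` `[p.1, p.2])]
    (filter_prod (ninfty_nbhs R) (pinfty_nbhs R)).

Definition truncated_mean (K : mean R) (H : set R) (p : R * R) : \bar R :=
  mean_val K (H `&` `[p.1, p.2]).

Definition extended_mean (K : mean R) : mean R := Mean
  [set H | [/\ mu_measurable H, 0 < mu_bar H, locally_finite_on H &
            cvg (truncated_mean K H @ truncation_filter H)]]
  (fun H => lim (truncated_mean K H @ truncation_filter H)).

End measure_mean.

(* Main.v *)
Require Import Defs.
From mathcomp Require Import all_boot all_order all_algebra.
From mathcomp Require Import all_classical all_reals all_analysis.
From mathcomp Require Import lra.
Import Order.TTheory GRing.Theory Num.Theory.
Import numFieldNormedType.Exports.
Local Open Scope classical_set_scope.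
Local Open Scope ring_scope.
Local Open Scope ereal_scope.

(** Let [m] be a lower bound of [H]. The part of [H] below any level [B] lies in
    [`[m, B]], hence carries only a finite mass [c], whereas the mass [N] of the
    truncation of [H] to [`[x, y]] tends to infinity, because [H] has infinite
    measure. Mass below [B] contributes at least [m] per unit to the integral
    and the rest at least [B], so the integral over the truncation is at least
    [B * N - (B - m) * c] (lemma [integral_ge_level]). As soon as
    [(B - m) * c <= N], which holds eventually (lemma [near_truncation_mu_ge]),
    this is at least [(B - 1) * N], i.e. the mean is at least [B - 1]. Since [B]
    is arbitrary the truncated means tend to [+oo]. The same divergence of [N]
    shows that the pairs [x <= y] with a truncation of positive measure form a
    proper filter, so that the limit is unique and equals [+oo]. *)

(** Integrate the pointwise bound [B - (B - m) * 1_(f < B) <= f]. *)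
Lemma integral_ge_level (d : measure_display) (T : measurableType d)
    (R : realType) (nu : {measure set T -> \bar R}) (S : set T) (f : T -> R)
    (m B : R) :
  measurable S -> nu S < +oo -> measurable_fun S f -> [bounded f x | x in S] ->
  (forall x, S x -> (m <= f x)%R) ->
  B%:E * nu S - (B - m)%:E * nu (S `&` f @^-1` `]-oo, B[) <=
    \int[nu]_(x in S) (f x)%:E.
Proof.
move=> mS Sfin mf bf mlef.
set L := S `&` f @^-1` `]-oo, B[.
have mL : measurable L by exact: mf.
have ic (r : R) : nu.-integrable S (EFin \o cst r).
  apply: measurable_bounded_integrable => //.
  by exists `|r|%R; split; [exact: num_real|move=> M rM x _; exact: ltW].
have i1 : nu.-integrable S (EFin \o (\1_L : T -> R)).
  apply: measurable_bounded_integrable => //.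
  exists 1%R; split; [exact: num_real|move=> M M1 x _ /=].
  by rewrite indicE ger0_norm// (le_trans _ (ltW M1))// lern1 leq_b1.
have iL : nu.-integrable S (fun x => (B - m)%:E * (\1_L x)%:E).
  exact: integrableZl.
have -> : B%:E * nu S - (B - m)%:E * nu L =
    \int[nu]_(x in S) (B%:E - (B - m)%:E * (\1_L x)%:E).
  rewrite (integralB mS (ic B) iL) /= (integral_cst nu mS B%:E).
  rewrite integralZl// integral_indic//.
  by rewrite (setIidl (_ : L `<=` S))//; exact: subIsetl.
apply: le_integral => //.
- exact: (integrableB mS (ic B) iL).
- exact: measurable_bounded_integrable.
move=> x /set_mem Sx; rewrite -EFinM -EFinB lee_fin indicE.
have [xL|xL] := boolP (x \in L); rewrite ?mulr1 ?mulr0.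
  by have := mlef _ Sx; lra.
rewrite subr0 leNgt; apply: contra xL => fxB.
by rewrite inE; split => //=; rewrite in_itv.
Qed.

(** Continuity from below along the integers, extended to all real [y] by
    monotonicity. *)
Lemma measure_truncation_cvgy (d : measure_display) (T : measurableType d)
    (R : realType) (nu : {measure set T -> \bar R}) (S : set T) (f : T -> R)
    (m : R) :
  measurable S -> measurable_fun setT f -> (forall x, S x -> (m <= f x)%R) ->
  nu S = +oo -> nu (S `&` f @^-1` `[m, y]) @[y --> +oo%R] --> +oo.
Proof.
move=> mS mf mlef nuS.
have mF (y : R) : measurable (S `&` f @^-1` `[m, y]).
  apply: measurableI => //; rewrite -[X in measurable X]setTI; exact: mf.
pose F (n : nat) := S `&` f @^-1` `[m, n%:R].
have FS : \bigcup_n F n = S.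
  apply/seteqP; split => [x [n _ []]//|x Sx].
  exists (Num.truncn (f x)).+1 => //; split => //=.
  by rewrite in_itv /= mlef// ltW// truncnS_gt.
have : nu \o F @ \oo --> +oo.
  rewrite -nuS -[in X in _ --> X]FS; apply: nondecreasing_cvg_mu => //.
  - by move=> n; exact: mF.
  - by rewrite FS.
  - move=> i j ij; apply/subsetPset => x [Sx] /=.
    rewrite in_itv /= => /andP[mx xi]; split => //=.
    by rewrite in_itv /= mx (le_trans xi)// ler_nat.
move=> /cvgeyPge cF; apply/cvgeyPge => A.
have [n _ /(_ n (leqnn n)) An] := cF A.
near=> y; apply: (le_trans An).
apply: le_measure; rewrite ?inE; [exact: mF|exact: mF|].
move=> x [Sx] /=; rewrite in_itv /= => /andP[mx xn]; split => //=.
by rewrite in_itv /= mx (le_trans xn).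
Unshelve. all: by end_near. Qed.

Lemma measurable_fun_id_caratheodory (R : realType)
    (mu : {measure set (measurableTypeR R) -> \bar R}) :
  measurable_fun (setT : set (caratheodory_type (mu^*)%mu)) (id : R -> R).
Proof.
move=> _ Y mY; rewrite setTI; apply: sub_caratheodory.
exact: sub_sigma_algebra.
Qed.

Lemma mu_measurableI_itv (R : realType)
    (mu : {measure set (measurableTypeR R) -> \bar R}) (H : set R)
    (i : interval R) :
  mu_measurable mu H -> mu_measurable mu (H `&` [set` i]).
Proof.
move=> mH; apply: measurableI => //.
have := measurable_fun_id_caratheodory R mu measurableT _ (measurable_itv i).
by rewrite setTI.
Qed.

(** Once [x] is below the lower bound [m], the truncation to [`[x, y]] contains
    the one to [`[m, y]], whose mass diverges with [y]. *)
Lemma near_truncation_mu_ge (R : realType)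
    (mu : {measure set (measurableTypeR R) -> \bar R}) (H : set R) (m C : R) :
  mu_measurable mu H -> (forall x, H x -> (m <= x)%R) -> mu_bar mu H = +oo ->
  \forall p \near filter_prod (ninfty_nbhs R) (pinfty_nbhs R),
    (p.1 <= p.2)%R /\ C%:E <= mu_bar mu (H `&` `[p.1, p.2]).
Proof.
move=> mH mleH Hoo.
have /cvgeyPge/(_ C) hC := @measure_truncation_cvgy _
  (caratheodory_type (mu^*)%mu) R (mu_bar mu) H id m mH
  (measurable_fun_id_caratheodory R mu) mleH Hoo.
have ym : \forall y \near +oo%R, (m <= y)%R by exact/nbhs_pinfty_ge/num_real.
exists ([set x | (x <= m)%R],
    [set y | (m <= y)%R /\ C%:E <= mu_bar mu (H `&` `[m, y])]).
  by split; [exact/nbhs_ninfty_le/num_real|exact: (filterI ym hC)].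
move=> [x y] /= [xm [my CN]]; split; first exact: le_trans my.
apply: (le_trans CN).
apply: le_measure; rewrite ?inE; [exact: mu_measurableI_itv..|].
move=> z [Hz]; rewrite /= !in_itv /= => /andP[mz zy]; split => //.
by rewrite (le_trans xm).
Qed.

Lemma truncation_filter_proper (R : realType)
    (mu : {measure set (measurableTypeR R) -> \bar R}) (H : set R) (m : R) :
  mu_measurable mu H -> (forall x, H x -> (m <= x)%R) -> mu_bar mu H = +oo ->
  ProperFilter (truncation_filter mu H).
Proof.
move=> mH mleH Hoo.
have wF : Filter (truncation_filter mu H) by exact: within_filter.
apply: Build_ProperFilter_ex => Q PQ.
have [p [[p12 Cp] Qp]] :=
  filter_ex (filterI (near_truncation_mu_ge R mu H m 1 mH mleH Hoo) PQ).
by exists p; apply: Qp; split => //; apply: lt_le_trans Cp; rewrite lte_fin.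
Qed.

Lemma truncated_mean_cvgy (R : realType)
    (mu : {measure set (measurableTypeR R) -> \bar R}) (H : set R) (m : R) :
  mu_measurable mu H -> locally_finite_on mu H ->
  (forall x, H x -> (m <= x)%R) -> mu_bar mu H = +oo ->
  truncated_mean (bounded_restriction (measure_mean mu)) H @
    truncation_filter mu H --> +oo.
Proof.
move=> mH Hfin mleH Hoo.
have FF := truncation_filter_proper R mu H m mH mleH Hoo.
apply/cvgeyPge => A.
(* The level is one above the target [A], since the mass below it may lower the
   mean by as much as 1, and at least [m], so that [B - m] is nonnegative. *)
pose B := Num.max (A + 1)%R m.
have AB : (A + 1 <= B)%R by rewrite le_max lexx.
have mB : (m <= B)%R by rewrite le_max lexx orbT.
have cfin : mu_bar mu (H `&` `[m, B]) \is a fin_num.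
  by rewrite ge0_fin_numE//; exact: Hfin.
pose c := fine (mu_bar mu (H `&` `[m, B])).
rewrite /truncation_filter near_withinE.
apply: filterS (near_truncation_mu_ge R mu H m ((B - m) * c) mH mleH Hoo).
move=> [x y] [_ cN] [xy N0].
set S := H `&` `[x, y] in cN N0.
change (A%:E <= (\int[mu_bar mu]_(z in S) (z : R)%:E) / mu_bar mu S).
have mS : mu_measurable mu S by exact: mu_measurableI_itv.
have Nfin : mu_bar mu S \is a fin_num.
  by rewrite ge0_fin_numE//; exact: Hfin.
have bS : [bounded (z : R) | z in S].
  exists (Num.max `|x| `|y|)%R; split; first exact: num_real.
  move=> M Mxy z [_] /=; rewrite in_itv /= => /andP[xz zy].
  move: Mxy; rewrite gt_max => /andP[xM yM].
  move: xM yM; rewrite !ltr_norml ler_norml; lra.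
have := @integral_ge_level _ (caratheodory_type (mu^*)%mu) R (mu_bar mu) S id
  m B mS (Hfin _ _ xy)
  (measurable_funTS (measurable_fun_id_caratheodory R mu)) bS
  (fun z Sz => mleH z (proj1 Sz)).
set L := S `&` _; set I := \int[_]_(_ in _) _ => lvl.
have Lc : mu_bar mu L <= c%:E.
  rewrite fineK//.
  apply: le_measure; rewrite ?inE; [exact: mu_measurableI_itv..|].
  move=> z [[Hz _]] /=; rewrite !in_itv /= => zB; split => //.
  by rewrite mleH// ltW.
have Lfin : mu_bar mu L \is a fin_num.
  by rewrite ge0_fin_numE// (le_lt_trans Lc)// ltry.
move: cN N0 lvl Lc; rewrite -(fineK Nfin) -(fineK Lfin) => cN N0 lvl Lc.
rewrite lte_fin in N0; rewrite lee_fin in cN; rewrite lee_fin in Lc.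
rewrite inver gt_eqF// lee_pdivlMr//; apply: le_trans lvl.
rewrite -!EFinM -EFinB lee_fin.
set N := fine (mu_bar mu S) in cN N0 *; set l := fine _ in Lc *.
have h1 : ((B - m) * l <= (B - m) * c)%R by rewrite ler_wpM2l// subr_ge0.
have h2 : ((A + 1) * N <= B * N)%R by rewrite ler_wpM2r// ltW.
lra.
Qed.

Theorem proposition5p1 (R : realType) (mu : {measure set (measurableTypeR R) -> \bar R})
    (H : set R) :
  mu_measurable mu H ->
  locally_finite_on mu H ->
  -oo < ereal_inf (EFin @` H) ->
  mu_bar mu H = +oo ->
  let K := bounded_restriction (measure_mean mu) in
  mean_dom (extended_mean mu K) H /\ mean_val (extended_mean mu K) H = +oo.
Proof.
move=> mH Hfin infH Hoo K.
have [m mleH] : exists m : R, forall x, H x -> (m <= x)%R.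
  have lb x : H x -> ereal_inf (EFin @` H) <= x%:E.
    by move=> Hx; apply: ereal_inf_lbound; exists x.
  move: infH lb; case: (ereal_inf _) => [r _ lb|_ lb|//].
    by exists r => x /lb; rewrite lee_fin.
  (* An infimum equal to [+oo] leaves [H] empty. *)
  by exists 0%R => x /lb.
have FF := truncation_filter_proper R mu H m mH mleH Hoo.
have cv := truncated_mean_cvgy R mu H m mH Hfin mleH Hoo.
split; last by apply/cvg_lim.
by split => //; [rewrite Hoo ltry|apply/cvg_ex; exists +oo].
Qed.
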